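(* Let $S$ be a finite semigroup with zero $0$ such that $R(S)=\{0\}$, and let $\mathcal{M}$ be a non-empty set of minimal idempotents of $S$ such that (1) the elements of $\mathcal{M}$ commute pairwise; (2) for every $0\neq x\in S$ there exist $e,f\in\mathcal{M}$ such that $exf\neq 0$; (3) for all $x,y\in S$ and all $e,f\in\mathcal{M}$ one has $\{exgyf: g\in\mathcal{M}\}\subset\{0,exyf\}$, and moreover $\{exgyf:g\in\mathcal{M}\}\neq\{0\}$ if $exyf\neq 0$. Let $\mathcal{M}=\mathcal{M}_1\cup\dots\cup\mathcal{M}_k$ be the decomposition of $\mathcal{M}$ into equivalence classes with respect to the restriction of the $\mathcal{D}$-relation, and let $n=\max_i|\mathcal{M}_i|$. Then the nilpotency class of every nilpotent subsemigroup of $S$ does not exceed $n$, the nilpotency class of every maximal nilpotent subsemigroup of $S$ equals $n$, and for every positive integer $m\leq n$ the maps $T\mapsto\rho_T$ and $\rho\mapsto\mathrm{Mon}(\rho)$ induce mutually inverse bijections between the set of all maximal elements of $\mathrm{Nil}_m(S)$ and the set $\mathrm{Ord}^{\mathrm{part}}_m(\mathcal{M})$.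
   Context: A nilpotent subsemigroup of $S$ is a subsemigroup $T\subset S$ with $T^m=\{0\}$ for some $m\in\mathbb{N}$; the least such $m$ is its nilpotency class. A maximal nilpotent subsemigroup is an inclusion-maximal nilpotent subsemigroup. $\mathrm{Nil}_m(S)$ is the set of nilpotent subsemigroups of $S$ of nilpotency class $\leq m$, ordered by inclusion. $S^1$ is $S$ with an identity adjoined if $S$ has none; $(a)=S^1aS^1$; $R(S)=\{x\in S:(x)\text{ is a nilpotent semigroup}\}$. In a finite semigroup Green's relations $\mathcal{D}$ and $\mathcal{J}$ coincide, and $\mathcal{D}$-classes are partially ordered by $\mathcal{D}_a\leq\mathcal{D}_b\Leftrightarrow(a)\subset(b)$. A non-zero $\mathcal{D}$-class $D$ is minimal if $D'\leq D$ implies $D'=D$ or $D'=\{0\}$. When $R(S)=\{0\}$, an idempotent is minimal if it lies in a minimal $\mathcal{D}$-class of $S$. For a strict partial order $\rho$ on $\mathcal{M}$ put $\mathrm{Mon}(\rho)=\{x\in S: \text{for all } e,f\in\mathcal{M},\ exf\neq 0\text{ implies }(e,f)\in\rho\}$. For a nilpotent subsemigroup $T$ of $S$ put $\rho_T=\{(e,f)\in\mathcal{M}\times\mathcal{M}: exf\neq 0\text{ for some }x\in T\}$. An ordered partition of a set $M$ into $l$ blocks is a partition $M=M_1\cup\dots\cup M_l$ into $l$ non-empty blocks, with the order of the blocks taken into account; put $\mathrm{Ord}(M_1,\dots,M_l)=\bigcup_{1\leq i<j\leq l}M_i\times M_j$. $\mathrm{Ord}^{\mathrm{part}}_m(\mathcal{M})$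 is the set of all partial orders $\rho=\rho_1\cup\dots\cup\rho_k$ on $\mathcal{M}$, where for each $i$: if $|\mathcal{M}_i|\geq m$, then $\rho_i=\mathrm{Ord}(\mathcal{M}_i^{(1)},\dots,\mathcal{M}_i^{(m)})$ for some ordered partition $\mathcal{M}_i=\mathcal{M}_i^{(1)}\cup\dots\cup\mathcal{M}_i^{(m)}$ of $\mathcal{M}_i$ into $m$ blocks; if $|\mathcal{M}_i|<m$, then $\rho_i$ is some (strict) linear order on $\mathcal{M}_i$. *)

(* Defs.v *)
From HB Require Import structures.
From mathcomp Require Import all_boot.

Set Implicit Arguments.
Unset Strict Implicit.
Unset Printing Implicit Defensive.

Local Open Scope group_scope.

#[short(type="finSemigroupType")]
HB.structure Definition FinSemigroup := {G of Finite G & Semigroup G}.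

Section Semigroups.

Variable S : finSemigroupType.

Implicit Types (a b e f g x y zero : S) (A B T M : {set S}).
Implicit Types (rho : {set S * S}) (m l : nat).

Definition is_zero zero : Prop := forall x, zero * x = zero /\ x * zero = zero.

(* An element of S^1 is encoded as u : option S, None being an identity.      *)
(* When S already has an identity, None acts on S as that identity does, so   *)
(* S^1 a, a S^1 and S^1 a S^1 are the same sets whether it is adjoined or not.*)
Definition mul1l (u : option S) x : S := if u is Some s then s * x else x.
Definition mul1r x (u : option S) : S := if u is Some s then x * s else x.

Definition left_ideal a : {set S} := [set mul1l u a | u : option S].
Definition right_ideal a : {set S} := [set mul1r a u | u : option S].
Definition ideal a : {set S} :=
  [set mul1r (mul1l u a) v | u : option S, v : option S].

Definition greenL : rel S := [rel a b | left_ideal a == left_ideal b].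
Definition greenR : rel S := [rel a b | right_ideal a == right_ideal b].
Definition greenD : rel S := [rel a b | [exists c, greenL a c && greenR c b]].

Definition Dclass a : {set S} := [set b | greenD a b].

(* The class of b lies below the class of a iff (b) is contained in (a).      *)
Definition minimal_Dclass zero a : Prop :=
  Dclass a != [set zero] /\
  forall b, ideal b \subset ideal a ->
    Dclass b = Dclass a \/ Dclass b = [set zero].

Definition minimal_idempotent zero e : Prop :=
  e * e = e /\ minimal_Dclass zero e.

Definition set_mul A B : {set S} := [set x * y | x in A, y in B].

(* T^m for m > 0; the value set0 at m = 0 is never used.                      *)
Definition set_pow T m : {set S} := iterop m set_mul T set0.

Definition subsemigroup T : Prop := T != set0 /\ mulg_closed (mem T).

Definition nilpotent_subsemigroup zero T : Prop :=
  subsemigroup T /\ exists2 m, 0 < m & set_pow T m = [set zero].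

Definition nilpotency_class zero T c : Prop :=
  [/\ 0 < c, set_pow T c = [set zero]
    & forall m, 0 < m -> set_pow T m = [set zero] -> c <= m].

Definition Nil_class_le zero m T : Prop :=
  nilpotent_subsemigroup zero T /\
  exists2 c, nilpotency_class zero T c & c <= m.

Definition maximal_in (P : {set S} -> Prop) T : Prop :=
  P T /\ forall U : {set S}, P U -> T \subset U -> U = T.

Definition in_R zero x : Prop := nilpotent_subsemigroup zero (ideal x).

Definition Mon zero M rho : {set S} :=
  [set x | [forall e in M, forall f in M,
    (e * x * f != zero) ==> ((e, f) \in rho)]].

Definition rho_of zero M T : {set S * S} :=
  [set p in setX M M | [exists x in T, p.1 * x * p.2 != zero]].

Definition strict_order_on A rho : Prop :=
  [/\ rho \subset setX A A,
      forall a, (a, a) \notin rho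
    & forall a b c, (a, b) \in rho -> (b, c) \in rho -> (a, c) \in rho].

Definition strict_linear_order_on A rho : Prop :=
  strict_order_on A rho /\
  {in A &, forall a b, a != b -> ((a, b) \in rho) || ((b, a) \in rho)}.

Definition ordered_partition A l (B : 'I_l -> {set S}) : Prop :=
  [/\ A = \bigcup_(i < l) B i,
      forall i, B i != set0
    & forall i j, i != j -> [disjoint B i & B j]].

Definition Ord l (B : 'I_l -> {set S}) : {set S * S} :=
  \bigcup_(i < l) \bigcup_(j < l | i < j) setX (B i) (B j).

Definition Dclasses_of M : {set {set S}} := equivalence_partition greenD M.

Definition ord_part_block m A rho : Prop :=
  if m <= #|A| then
    exists2 B : 'I_m -> {set S}, ordered_partition A B & rho = Ord B
  else strict_linear_order_on A rho.

Definition Ord_part M m rho : Prop :=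
  strict_order_on M rho /\
  exists2 r : {set S} -> {set S * S},
    forall A, A \in Dclasses_of M -> ord_part_block m A (r A)
    & rho = \bigcup_(A in Dclasses_of M) r A.

End Semigroups.

(* Main.v *)
(* The minimal idempotents in M are pairwise orthogonal, and e x f <> 0 for
   some x exactly when e and f are D-related.  Since nonzero elements of a
   0-minimal ideal can be cancelled (the ideal is completely 0-simple), e x f <> 0
   and f y g <> 0 give e x f y g <> 0; condition (3) then says that
   e x y g <> 0 iff e x f <> 0 and f y g <> 0 for some f in M.  Hence rho_T is a
   strict order inside the D-relation, and T^m = {0} iff rho_T has no chain of
   m + 1 idempotents, i.e. iff it has a strictly increasing level function with
   values below m.  The maps rho_T and Mon(rho) thus form a Galois
   correspondence, and it remains to find the maximal orders with m levels: on
   every D-block A a level function can be refined so as to take all of the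
   min(m, #|A|) possible values, which yields an ordered partition into m blocks
   or, when #|A| < m, a linear order. *)
Require Import Defs.
From mathcomp Require Import all_boot zify.

Set Implicit Arguments.
Unset Strict Implicit.
Unset Printing Implicit Defensive.

Local Open Scope group_scope.

(** * Level functions on a finite set *)

Definition onto_levels (T : finType) (A : {set T}) (d : nat) (h : T -> nat) :=
  (forall a, a \in A -> h a < d) /\
  (forall i, i < d -> exists2 a, a \in A & h a = i).

Section Levels.

Variables (T : finType) (A : {set T}).

(** A value [i] missed by [h] on [A] can be closed up: levels above [i] drop by one, and no strict
    inequality is lost because nothing sits at [i]. *)
Lemma compress_levels m (h : T -> nat) :
  (forall a, a \in A -> h a < m) ->
  exists d (h' : T -> nat), [/\ d <= m, onto_levels A d h'
    & {in A &, forall a b, h a < h b -> h' a < h' b}].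
Proof.
elim: m h => [|m IHm] h hm; first by exists 0, h; split=> //; split.
have [/forallP onto | ] :=
  boolP [forall i : 'I_m.+1, [exists a in A, h a == i]].
  exists m.+1, h; split=> //; split=> // i im.
  by have /exists_inP[a aA /eqP] := onto (Ordinal im); exists a.
case/forallPn=> i /exists_inPn gap.
have [a aA | d [h' [dm h'onto h'mono]]] := IHm (fun a => h a - (i < h a)).
  have := hm a aA; have := gap a aA; have := ltn_ord i.
  by case: (ltngtP i (h a)); lia.
exists d, h'; split=> [||a b aA bA hab] //; first exact: leqW.
apply: h'mono => //=.
have := gap a aA; have := gap b bA.
by case: (ltngtP i (h a)); case: (ltngtP i (h b)); lia.
Qed.

Lemma onto_levels_card d h : onto_levels A d h -> d <= #|A|.
Proof.
case=> _ onto; rewrite cardE -(size_iota 0 d) -(size_map h).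
apply: uniq_leq_size (iota_uniq 0 d) _ => i; rewrite mem_iota /= add0n.
by case/onto=> a aA <-; apply/mapP; exists a; rewrite ?mem_enum.
Qed.

Lemma onto_levels_inj h : onto_levels A #|A| h -> {in A &, injective h}.
Proof.
case=> _ onto.
have sub : {subset iota 0 #|A| <= map h (enum A)}.
  move=> i; rewrite mem_iota /= add0n => /onto[a aA <-].
  by apply/mapP; exists a; rewrite ?mem_enum.
have Uh : uniq (map h (enum A)).
  by apply: leq_size_uniq (iota_uniq 0 _) sub _; rewrite size_map size_iota -cardE.
move=> a b aA bA hab; rewrite -mem_enum in aA; rewrite -mem_enum in bA.
rewrite -(nth_index a aA) -(nth_index a bA).
congr nth; apply/eqP.
rewrite -(nth_uniq (h a) _ _ Uh) ?size_map ?index_mem //.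
by rewrite !(nth_map a) ?index_mem // !nth_index // hab.
Qed.

(** While [d < #|A|], two distinct elements [a] and [b] share a level. Keeping [b] in place and
    raising [a] and all higher levels by one creates a new level. *)
Lemma refine_levels d l h : onto_levels A d h -> d <= l -> l <= #|A| ->
  exists2 h', onto_levels A l h'
    & {in A &, forall a b, h a < h b -> h' a < h' b}.
Proof.
move=> hd dl lA; move: {2}(l - d) (erefl (l - d)) => k.
elim: k d h hd dl => [|k IHk] d h hd dl def_k.
  by exists h => //; have -> : l = d by lia.
have [hlt onto] := hd.
have dA : d < #|A| by lia.
have [a [b [aA bA abN hab]]] :
    exists a b, [/\ a \in A, b \in A, a != b & h a = h b].
  have [/dinjectiveP inj_h | /dinjectivePn] := boolP (dinjectiveb h A).
    suff : #|A| <= d by lia.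
    rewrite cardE -(size_iota 0 d) -(size_map h).
    apply: uniq_leq_size => [|i /mapP[a]]; last first.
      by rewrite mem_enum mem_iota => /hlt ? ->.
    rewrite map_inj_in_uniq ?enum_uniq // => a b.
    by rewrite !mem_enum; apply: inj_h.
  by case=> a aA [b]; rewrite !inE => /andP[ba bA] hab; exists b, a.
pose h' x := h x + ((h a < h x) || (x == a)).
have mono x y : h x < h y -> h' x < h' y.
  rewrite /h'; case: eqP => [->|_]; case: eqP => [->|_]; lia.
have [|||h2 h2l h2mono] := IHk d.+1 h'; [split|lia|lia|].
- by move=> x xA; have := hlt x xA; rewrite /h'; case: orb; lia.
- move=> i id; case: (ltngtP i (h a)) => [ia|ia|->].
  + have [|x xA hx] := onto i; first by have := hlt a aA; lia.
    exists x => //; rewrite /h' hx; case: eqP => [xa|_]; last by lia.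
    by rewrite xa in hx; lia.
  (* The new level [i] is the old level [i.-1] shifted up, or [a] alone when [i.-1 = h a]. *)
  + have [|x xA hx] := onto i.-1; first by lia.
    case: (eqVneq x a) => [xa|xa]; last first.
      case: (ltnP (h a) i.-1) => ai.
        by exists x => //; rewrite /h' hx ai /=; lia.
      by exists a => //; rewrite /h' eqxx orbT; lia.
    by exists a => //; rewrite /h' eqxx orbT; rewrite xa in hx; lia.
  + exists b => //; rewrite /h' -hab ltnn eq_sym (negPf abN); lia.
by exists h2 => // x y xA yA /mono; apply: h2mono.
Qed.

Lemma normalize_levels m (h : T -> nat) : (forall a, a \in A -> h a < m) ->
  exists2 h', onto_levels A (minn m #|A|) h'
    & {in A &, forall a b, h a < h b -> h' a < h' b}.
Proof.
move=> /compress_levels[d [h1 [dm h1onto h1mono]]].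
have dA := onto_levels_card h1onto.
have [||h2 h2onto h2mono] := @refine_levels d (minn m #|A|) h1 h1onto.
- by rewrite leq_min dm.
- exact: geq_minr.
by exists h2 => // a b aA bA hab; apply/h2mono/h1mono.
Qed.

End Levels.

(** * Ordered partitions of a single block *)

Section OrderedBlocks.

Variable S : finSemigroupType.
Implicit Types (A : {set S}) (rho : {set S * S}).

Lemma mem_Ord l (B : 'I_l -> {set S}) a b :
  reflect (exists i j : 'I_l, [/\ i < j, a \in B i & b \in B j])
    ((a, b) \in Ord B).
Proof.
apply: (iffP bigcupP) => [[i _ /bigcupP[j ij]]|[i [j [ij aB bB]]]].
  by case/setXP=> aB bB; exists i, j.
by exists i => //; apply/bigcupP; exists j => //; apply/setXP.
Qed.

Lemma partition_unique l A (B : 'I_l -> {set S}) i j a :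
  ordered_partition A B -> a \in B i -> a \in B j -> i = j.
Proof.
case=> _ _ dis ai aj; apply/eqP; apply: contraTT ai => ij.
by rewrite (disjointFl (dis i j ij) aj).
Qed.

Lemma ord_part_block_sub m A rho : ord_part_block m A rho -> rho \subset setX A A.
Proof.
rewrite /ord_part_block; case: ifP => _; last by case=> -[].
case=> B [-> _ _] ->; apply/subsetP=> -[a b] /mem_Ord[i [j [_ ai bj]]].
by apply/setXP; split; apply/bigcupP; [exists i | exists j].
Qed.

Lemma ord_part_block_levels m A rho : 0 < m -> ord_part_block m A rho ->
  exists h : S -> nat, forall a b, (a, b) \in rho -> h a < h b < m.
Proof.
move=> m_gt0; rewrite /ord_part_block; case: leqP => mA.
  (* The maximum reads off the index of the unique block containing [a]. *)
  case=> B pB ->; exists (fun a => \max_(i < m | a \in B i) i) => a b.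
  case/mem_Ord=> i [j [ij ai bj]].
  have val_max k c : c \in B k -> \max_(i < m | c \in B i) i = k.
    move=> ck; rewrite (bigD1 k) //= big1 ?maxn0 // => k' /andP[ck'].
    by rewrite (partition_unique pB ck' ck) eqxx.
  by rewrite (val_max i) // (val_max j) // ij /=.
(* For a linear order the level counts predecessors; they all lie in [A], so it is at most
   [#|A| < m]. *)
case=> -[sub irr tr] _; exists (fun a => #|[set b | (b, a) \in rho]|) => a b ab.
have /setXP[aA bA] := subsetP sub _ ab.
apply/andP; split.
  apply/proper_card/properP; split.
    by apply/subsetP=> c; rewrite !inE => ca; apply: tr ca ab.
  by exists a; rewrite !inE ?ab // (negPf (irr a)).
apply: leq_ltn_trans mA; apply/subset_leq_card/subsetP=> c.
by rewrite inE => /(subsetP sub) /setXP[].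
Qed.

(** Each passage to the next block, which is never empty, is a pair of [rho] and so raises [h] by at
    least one. *)
Lemma Ord_climb l A (B : 'I_l -> {set S}) rho (h : S -> nat) :
  ordered_partition A B -> Ord B \subset rho ->
  (forall a b, (a, b) \in rho -> h a < h b) ->
  forall k (i j : 'I_l) a, a \in B i -> i + k = j ->
  exists2 b, b \in B j & h a + k <= h b.
Proof.
case=> _ nz _ sub hmono; elim=> [|k IHk] i j a ai.
  by rewrite addn0 => ij; exists a; rewrite ?addn0 // -(ord_inj ij).
move=> ij; have kl : i + k < l by have := ltn_ord j; lia.
have [b bk hb] := IHk i (Ordinal kl) a ai (erefl _).
have /set0Pn[c cj] := nz j.
exists c => //; have : h b < h c; last by lia.
apply/hmono/(subsetP sub)/mem_Ord; exists (Ordinal kl), j.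
by split=> //=; lia.
Qed.

(** [Ord_climb] ends at an unspecified element, so the climb goes from block 0 only to the block
    just before [i], all of whose elements precede [a]. *)
Lemma Ord_height l A (B : 'I_l -> {set S}) rho (h : S -> nat) :
  ordered_partition A B -> Ord B \subset rho ->
  (forall a b, (a, b) \in rho -> h a < h b) ->
  forall (i : 'I_l) a, a \in B i -> i <= h a.
Proof.
move=> pB sub hmono i a ai; have climb := Ord_climb pB sub hmono.
have l_gt0 : 0 < l by have := ltn_ord i; lia.
case def_i: (nat_of_ord i) => [|k] //.
have kl : k < l by have := ltn_ord i; lia.
have [_ nz _] := pB; have /set0Pn[b0 b0B] := nz (Ordinal l_gt0).
have [b bk hb] := climb k _ (Ordinal kl) _ b0B (erefl _).
have : h b < h a; last by lia.
apply/hmono/(subsetP sub)/mem_Ord; exists (Ordinal kl), i.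
by split=> //=; lia.
Qed.

(** With [m] blocks and only [m] values, [Ord_height] bounds [h] on block [i] from below by [i], and
    a climb to the last block bounds it from above. So [h] is the block index and increases only
    along [r]. In the linear case the reverse pair would make [h] decrease. *)
Lemma ord_part_block_maximal m A r rho (h : S -> nat) :
  ord_part_block m A r -> r \subset rho ->
  (forall a b, (a, b) \in rho -> h a < h b) -> (forall a, h a < m) ->
  {in A &, forall a b, (a, b) \in rho -> (a, b) \in r}.
Proof.
move=> bl sub hmono hm a b aA bA ab; have hab := hmono _ _ ab.
move: bl; rewrite /ord_part_block; case: ifP => _ [].
  move=> B pB defr; rewrite defr in sub *.
  have [defA _ _] := pB.
  have [m' def_m] : exists m', m = m'.+1 by exists m.-1; have := hm a; lia.
  have level (i : 'I_m) c : c \in B i -> h c = i.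
    move=> ci; have ic := Ord_height pB sub hmono ci.
    have lt_i := ltn_ord i.
    have last_m : m' < m by lia.
    have [|d _ hd] := Ord_climb pB sub hmono (k := m' - i)
      (j := Ordinal last_m) ci; first by rewrite /=; lia.
    by have := hm d; lia.
  move: aA bA; rewrite defA => /bigcupP[i _ ai] /bigcupP[j _ bj].
  by apply/mem_Ord; exists i, j; rewrite -(level i a) // -(level j b).
move=> _ lin; have a_neq_b : a != b by apply: contraTneq hab => ->; rewrite ltnn.
have [//|/= ba] := orP (lin a b aA bA a_neq_b).
by have := hmono _ _ (subsetP sub _ ba); lia.
Qed.

(** The blocks are the fibres of [h]; when [#|A| < m] they are singletons, whence a linear order. *)
Lemma onto_levels_block m A (h : S -> nat) : onto_levels A (minn m #|A|) h ->
  ord_part_block m A [set p in setX A A | h p.1 < h p.2].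
Proof.
move=> h_onto; rewrite /ord_part_block; case: leqP => mA.
  rewrite (minn_idPl mA) in h_onto; have [hlt onto] := h_onto.
  exists (fun i : 'I_m => [set a in A | h a == i]).
    split.
    - apply/setP=> a; apply/idP/bigcupP => [aA|[i _]].
        by exists (Ordinal (hlt a aA)); rewrite ?inE ?aA /=.
      by rewrite inE => /andP[].
    - move=> i; have [a aA ha] := onto i (ltn_ord i).
      by apply/set0Pn; exists a; rewrite inE aA ha eqxx.
    - move=> i j ij; rewrite -setI_eq0; apply/eqP/setP=> a; rewrite !inE.
      apply: contraNF ij => /andP[/andP[_ /eqP hi] /andP[_ /eqP hj]].
      by apply/eqP/ord_inj; rewrite -hi.
  apply/setP=> -[a b]; rewrite !inE /=.
  apply/idP/mem_Ord => [/andP[/andP[aA bA] hab]|[i [j []]]].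
    exists (Ordinal (hlt a aA)), (Ordinal (hlt b bA)).
    by rewrite !inE aA bA !eqxx.
  by rewrite !inE => ij /andP[-> /eqP->] /andP[-> /eqP->].
rewrite (minn_idPr (ltnW mA)) in h_onto.
have inj_h := onto_levels_inj h_onto.
split; first split.
- by apply/subsetP=> p; rewrite inE => /andP[].
- by move=> a; rewrite !inE /= ltnn andbF.
- move=> a b c; rewrite !inE /= => /andP[/andP[-> _] hab] /andP[/andP[_ ->] hbc].
  exact: ltn_trans hab hbc.
move=> a b aA bA ab; rewrite !inE /= aA bA /= -neq_ltn.
by apply: contraNneq ab => /inj_h->.
Qed.

End OrderedBlocks.

(** * Ideals and stability in finite semigroups *)

Section FiniteSemigroups.

Variable S : finSemigroupType.
Implicit Types (a b e f p u v w x y z zero : S) (T U : {set S}).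

Lemma idealP a b : reflect
  (exists u v : option S, b = mul1r (mul1l u a) v) (b \in ideal a).
Proof.
apply: (iffP imset2P) => [[u v _ _ ->]|[u [v ->]]]; first by exists u, v.
by exists u v.
Qed.

Lemma ideal_sub a b : b \in ideal a -> ideal b \subset ideal a.
Proof.
case/idealP=> u [v ->]; apply/subsetP=> c /idealP[u' [v' ->]].
apply/idealP.
exists (if u' is Some s' then if u is Some s then Some (s' * s) else u' else u).
exists (if v' is Some s' then if v is Some s then Some (s * s') else v' else v).
by case: u => [s|]; case: v => [t|]; case: u' => [s'|]; case: v' => [t'|] /=;
  rewrite ?mulgA.
Qed.

Lemma greenD_ideal a b : greenD a b -> b \in ideal a.
Proof.
case/existsP=> c /andP[/eqP Lac /eqP Rcb].
have : c \in left_ideal a by rewrite Lac; apply/imsetP; exists None.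
case/imsetP=> u _ def_c.
have : b \in right_ideal c by rewrite Rcb; apply/imsetP; exists None.
by case/imsetP=> v _ ->; apply/idealP; exists u, v; rewrite def_c.
Qed.

Lemma Dclass_refl a : a \in Dclass a.
Proof. by rewrite inE; apply/existsP; exists a; rewrite /greenL /greenR /= !eqxx. Qed.

(* Left multiplication by p permutes the finite set f S, since it has the
   right inverse w there. *)
Lemma one_sided_inverse f p w :
  f * f = f -> f * p = p -> p * f = p -> f * w = w -> p * w = f -> w * p = f.
Proof.
move=> ff fp pf fw pw; pose G := [set z | f * z == z].
have im : [set p * z | z in G] = G.
  apply/setP=> z; apply/imsetP/idP => [[z' _ ->]|].
    by rewrite inE mulgA fp.
  rewrite inE => /eqP fz; exists (w * z); last by rewrite mulgA pw fz.
  by rewrite inE mulgA fw.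
have /imset_injP inj : #|[set p * z | z in G]| == #|G| by rewrite im.
(* Left multiplication by [p] sends both [w * p] and [f] to [p]. *)
by apply: inj; rewrite ?inE ?ff ?mulgA ?fw ?pw ?fp ?pf.
Qed.

(** Multiplying [f = u a v] by [f] on both sides makes the factors absorb [f], and turns an adjoined
    identity into the element [f] of [S]. *)
Lemma idempotent_in_ideal a f : f * f = f -> f \in ideal a ->
  exists u v, u * a * v = f /\ (f * u = u /\ v * f = v).
Proof.
move=> ff /idealP[u [v def_f]].
have fau : exists2 s, f * mul1l u a = s * a & f * s = s.
  by case: u def_f => [s|] _ /=; [exists (f * s) | exists f];
    rewrite ?mulgA ?ff.
have vf : exists2 t, (forall z, mul1r z v * f = z * t) & t * f = t.
  by case: v def_f => [s|] _ /=; [exists (s * f) | exists f] => *;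
    rewrite -?mulgA ?ff.
have [s sE fs] := fau; have [t tE tf] := vf.
exists s, t; split=> //; rewrite -sE -tE.
have -> : mul1r (f * mul1l u a) v = f * mul1r (mul1l u a) v.
  by case: v {def_f vf tE} => [r|] //=; rewrite mulgA.
by rewrite -def_f !ff.
Qed.

(** Stability of finite semigroups: [p = u * a] and [w = f * v] satisfy [p * w = f], which
    [one_sided_inverse] turns into [w * p = f]. *)
Lemma idempotent_left_divisor a f :
  f * f = f -> f \in ideal a -> a * f = a -> exists s, f = s * a.
Proof.
move=> ff /idempotent_in_ideal[//|u [v [def_f [fu vf]]]] af.
exists (f * v * u); rewrite -mulgA; apply/esym.
apply: (one_sided_inverse ff); rewrite -?mulgA ?af ?ff //.
- by rewrite mulgA fu.
- by rewrite mulgA ff.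
- by rewrite (mulgA a) af mulgA.
Qed.

(** The mirror image, with [p = u * f] and [w = a * v]. *)
Lemma idempotent_right_divisor a f :
  f * f = f -> f \in ideal a -> f * a = a -> exists s, f = a * s.
Proof.
move=> ff /idempotent_in_ideal[//|u [v [def_f [fu vf]]]] fa.
exists (v * (u * f)); rewrite mulgA; apply/esym.
apply: (one_sided_inverse ff); rewrite ?mulgA ?fu ?fa //.
- by rewrite -mulgA ff.
- by rewrite -!mulgA (mulgA f a) fa mulgA.
Qed.

(** * Powers of subsets and nilpotency classes *)

Lemma mem_set_mul T U x y : x \in T -> y \in U -> x * y \in set_mul T U.
Proof. by move=> xT yU; apply/imset2P; exists x y. Qed.

Lemma set_powS T k : set_pow T k.+2 = set_mul T (set_pow T k.+1).
Proof. by []. Qed.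

Lemma set_pow_neq0 T k : T != set0 -> set_pow T k.+1 != set0.
Proof.
case/set0Pn=> x xT; elim: k => [|k /set0Pn[y yT]]; apply/set0Pn; first by exists x.
by exists (x * y); rewrite set_powS mem_set_mul.
Qed.

Lemma set_pow_subset T U k : T \subset U -> set_pow T k.+1 \subset set_pow U k.+1.
Proof. by move=> TU; elim: k => [//|k IHk]; rewrite !set_powS imset2S. Qed.

Variable zero : S.
Hypothesis zeroP : is_zero zero.

Lemma mul0x x : zero * x = zero. Proof. by have [] := zeroP x. Qed.
Lemma mulx0 x : x * zero = zero. Proof. by have [] := zeroP x. Qed.

Lemma Dclass_zero : Dclass zero = [set zero].
Proof.
apply/setP=> b; rewrite inE inE; apply/idP/eqP => [/greenD_ideal|->].
  by case/idealP=> [[u|] [[v|] ->]] /=; rewrite ?mulx0 ?mul0x.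
by have := Dclass_refl zero; rewrite inE.
Qed.

Lemma set_pow_eq0 T k : T != set0 ->
  (forall x, x \in set_pow T k.+1 -> x = zero) -> set_pow T k.+1 = [set zero].
Proof.
move=> nz all0; apply/setP=> x; rewrite inE; apply/idP/eqP => [/all0//|->].
by have /set0Pn[y yT] := set_pow_neq0 k nz; rewrite -(all0 y yT).
Qed.

Lemma set_pow_eq0_leq T c m : T != set0 -> 0 < c -> c <= m ->
  set_pow T c = [set zero] -> set_pow T m = [set zero].
Proof.
move=> nz c_gt0 /subnK <- Tc; elim: (m - c) => [|k IHk] //.
have def_c : c = c.-1.+1 by lia.
rewrite addSn def_c addnS; apply: set_pow_eq0 => // x; rewrite set_powS.
by case/imset2P=> y z _; rewrite -addnS -def_c IHk inE => /eqP -> ->; rewrite mulx0.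
Qed.

Lemma nilpotency_class_exists T : nilpotent_subsemigroup zero T ->
  exists c, nilpotency_class zero T c.
Proof.
case=> _ [m m_gt0 Tm].
have exT : exists m, (0 < m) && (set_pow T m == [set zero]).
  by exists m; rewrite m_gt0 Tm eqxx.
case: (ex_minnP exT) => c /andP[c_gt0 /eqP Tc] min_c.
by exists c; split=> // k k_gt0 Tk; apply: min_c; rewrite k_gt0 Tk eqxx.
Qed.

(** A power equal to [{0}] stays so for larger exponents, so a bound on the class becomes a single
    equation. *)
Lemma Nil_class_leP m T : 0 < m ->
  Nil_class_le zero m T <-> subsemigroup T /\ set_pow T m = [set zero].
Proof.
move=> m_gt0; split=> [[[sT _] [c [c_gt0 Tc _] cm]] | [sT Tm]].
  by split=> //; apply: set_pow_eq0_leq cm Tc => //; case: sT.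
have nilT : nilpotent_subsemigroup zero T by split=> //; exists m.
split=> //; have [c cT] := nilpotency_class_exists nilT.
by exists c => //; case: cT => _ _; apply.
Qed.

End FiniteSemigroups.

(** * Orthogonality and linking of minimal idempotents *)

Section MinimalIdempotents.

Variables (S : finSemigroupType) (zero : S) (M : {set S}).
Implicit Types (a b e f g x y z : S) (A T U : {set S}) (rho : {set S * S}).

Hypothesis zeroP : is_zero zero.
Hypothesis M_minimal : forall e, e \in M -> minimal_idempotent zero e.
Hypothesis M_commute : {in M &, forall e f, e * f = f * e}.
Hypothesis M_detects : forall x, x != zero ->
  exists e f, [/\ e \in M, f \in M & e * x * f != zero].
Hypothesis M_insert : forall x y e f, e \in M -> f \in M ->
  [set e * x * g * y * f | g in M] \subset [set zero; e * x * y * f] /\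
  (e * x * y * f != zero -> [set e * x * g * y * f | g in M] != [set zero]).

Let z0x := mul0x zeroP.
Let zx0 := mulx0 zeroP.

Lemma M_idem e : e \in M -> e * e = e.
Proof. by case/M_minimal. Qed.

Lemma M_neq0 e : e \in M -> e != zero.
Proof.
case/M_minimal=> _ [De _]; apply: contraNneq De => ->.
by rewrite (Dclass_zero zeroP).
Qed.

Lemma Dclass_below e a : e \in M -> a \in ideal e -> a != zero ->
  Dclass a = Dclass e.
Proof.
case/M_minimal=> _ [_ min_e] ae a0.
have [|//|Da] := min_e a; first exact: ideal_sub.
by have := Dclass_refl a; rewrite Da inE (negPf a0).
Qed.

(** The ideal [(e)] is 0-minimal: a non-zero [a] in it is D-related to [e], hence generates it. *)
Lemma ideal_above e a : e \in M -> a \in ideal e -> a != zero -> e \in ideal a.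
Proof.
move=> eM ae a0; apply: greenD_ideal.
by have := Dclass_refl e; rewrite -(Dclass_below eM ae a0) inE.
Qed.

Lemma mul_left_divisor f a : f \in M -> a * f = a -> a != zero ->
  exists s, f = s * a.
Proof.
move=> fM af a0; apply: (idempotent_left_divisor (M_idem fM) _ af).
apply: ideal_above => //.
by apply/idealP; exists (Some a), None; rewrite /= af.
Qed.

Lemma mul_right_divisor f a : f \in M -> f * a = a -> a != zero ->
  exists s, f = a * s.
Proof.
move=> fM fa a0; apply: (idempotent_right_divisor (M_idem fM) _ fa).
apply: ideal_above => //.
by apply/idealP; exists None, (Some a); rewrite /= fa.
Qed.

(** If [e * f] is non-zero, then [f] lies in [S (e f)] and [e] in [(e f) S]. As [e * f = f * e]
    absorbs both idempotents on either side, [f * e] equals both [e] and [f]. *)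
Lemma M_orthogonal e f : e \in M -> f \in M -> e * f != zero -> e = f.
Proof.
move=> eM fM ef0; have ef := M_commute eM fM.
have [s fs] : exists s, f = s * (e * f).
  by apply: mul_left_divisor => //; rewrite -mulgA M_idem.
have [t et] : exists t, e = e * f * t.
  by apply: mul_right_divisor => //; rewrite mulgA M_idem.
have fef : f * (e * f) = e * f by rewrite ef mulgA M_idem.
have efe : e * f * e = e * f by rewrite -mulgA -ef mulgA M_idem.
have <- : f * e = e by rewrite {1}et mulgA fef.
by rewrite {1}fs -mulgA efe.
Qed.

(** Since [f = s * (e * x * f)] for some [s], a vanishing product would force [f * b] to vanish. *)
Lemma mul_glue e x f b : f \in M -> e * x * f != zero -> f * b != zero ->
  e * x * f * b != zero.
Proof.
move=> fM exf fb; have [|s fs] := mul_left_divisor fM _ exf.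
  by rewrite -mulgA M_idem.
by apply: contraNneq fb => eq0; rewrite fs -mulgA eq0 zx0.
Qed.

Lemma Dclass_eq_of_link e x f : e \in M -> f \in M -> e * x * f != zero ->
  Dclass e = Dclass f.
Proof.
move=> eM fM exf; rewrite -(Dclass_below eM (a := e * x * f)) //.
  apply: Dclass_below => //.
  by apply/idealP; exists (Some (e * x)), None.
by apply/idealP; exists None, (Some (x * f)); rewrite /= mulgA.
Qed.

Lemma greenD_linkP e f : e \in M -> f \in M ->
  greenD e f <-> exists x, e * x * f != zero.
Proof.
move=> eM fM; split=> [/greenD_ideal /idealP[u [v def_f]] | [x exf]]; last first.
  by have := Dclass_refl f; rewrite -(Dclass_eq_of_link eM fM exf) inE.
(* In [f = u e v] the right factor absorbs [f], which yields an element of [S] even when [v] is the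
   identity; [e * w = 0] would give [f = 0]. *)
pose w := if v is Some t then t * f else f.
have wf : w * f = w by rewrite /w; case: (v) => [t|]; rewrite -?mulgA (M_idem fM).
have def_w : f = mul1l u (e * w).
  rewrite -[LHS](M_idem fM) {1}def_f /w.
  by case: (u) => [s|]; case: (v) => [t|] /=; rewrite ?mulgA.
exists w; rewrite -mulgA wf; apply: contraNneq (M_neq0 fM) => ew.
by rewrite def_w ew; case: (u) => [s|] /=; rewrite ?zx0.
Qed.

Lemma greenD_eq e f : e \in M -> f \in M -> greenD e f -> Dclass e = Dclass f.
Proof. by move=> eM fM /(greenD_linkP eM fM)[x]; apply: Dclass_eq_of_link. Qed.

Definition D_block e : {set S} := [set f in M | greenD e f].

Lemma D_block_in e : e \in M -> D_block e \in Dclasses_of M.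
Proof. by move=> eM; apply: imset_f. Qed.

Lemma mem_D_block e : e \in M -> e \in D_block e.
Proof. by move=> eM; rewrite inE eM /=; have := Dclass_refl e; rewrite inE. Qed.

(** Related idempotents of [M] have equal D-classes by [greenD_eq], so any member determines its
    block. *)
Lemma DclassesP A e : A \in Dclasses_of M -> e \in A ->
  e \in M /\ A = D_block e.
Proof.
case/imsetP=> a aM ->; rewrite inE => /andP[eM ae]; split=> //.
by apply/setP=> f; have := greenD_eq aM eM ae; move/setP/(_ f); rewrite !inE => ->.
Qed.

(* Condition (3) read as: x y connects e to g iff x connects e to some f in M
   and y connects f to g. *)
Lemma link_mul e x f y g : e \in M -> f \in M -> g \in M ->
  e * x * f != zero -> f * y * g != zero -> e * (x * y) * g != zero.
Proof.
move=> eM fM gM exf fyg.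
have [/subsetP sub _] := M_insert x y eM gM.
have := mul_glue fM exf (b := y * g); rewrite mulgA => /(_ fyg).
(* By (3) this product, non-zero by [mul_glue], must equal [e * x * y * g]. *)
have /sub : e * x * f * y * g \in [set e * x * g0 * y * g | g0 in M].
  exact: (imset_f (fun h => e * x * h * y * g)).
by rewrite !inE !mulgA => /orP[/eqP-> | /eqP->]; rewrite ?eqxx.
Qed.

Lemma link_split e x y g : e \in M -> g \in M -> e * (x * y) * g != zero ->
  exists f, [/\ f \in M, e * x * f != zero & f * y * g != zero].
Proof.
move=> eM gM; rewrite mulgA => exyg.
have [_ /(_ exyg)] := M_insert x y eM gM.
(* If all products with an inserted idempotent vanished, the set in (3) would be [{0}]. *)
have [f /andP[fM nz] _|none /eqP[]] := pickP (fun f =>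
  (f \in M) && (e * x * f * y * g != zero)); last first.
  apply/setP=> z; rewrite !inE; apply/imsetP/eqP => [[f fM ->]|->].
    by have := none f; rewrite fM /= => /negbFE/eqP.
  by exists e => //; have := none e; rewrite eM /= => /negbFE/eqP.
exists f; split=> //.
  by apply: contraNneq nz => ->; rewrite !z0x.
by apply: contraNneq nz => eq0; rewrite -!mulgA [f * _]mulgA eq0 !zx0.
Qed.

(** * The correspondence between subsemigroups and orders *)

Lemma rho_ofP T e f : reflect
  [/\ e \in M, f \in M & exists2 x, x \in T & e * x * f != zero]
  ((e, f) \in rho_of zero M T).
Proof.
rewrite !inE /=; apply: (iffP andP) => [[/andP[eM fM] /exists_inP ex]|].
  by split.
by case=> -> -> ex; split=> //; apply/exists_inP.
Qed.

Lemma MonP rho x : reflect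
  {in M &, forall e f, e * x * f != zero -> (e, f) \in rho} (x \in Mon zero M rho).
Proof.
rewrite inE; apply: (iffP forall_inP) => [H e f eM fM|H e eM].
  exact/implyP/(forall_inP (H e eM)).
by apply/forall_inP=> f fM; apply/implyP/H.
Qed.

Lemma rho_of_greenD T e f : (e, f) \in rho_of zero M T -> greenD e f.
Proof.
by case/rho_ofP=> eM fM [x _ exf]; apply/(greenD_linkP eM fM); exists x.
Qed.

Lemma rho_of_trans T e f g : subsemigroup T ->
  (e, f) \in rho_of zero M T -> (f, g) \in rho_of zero M T ->
  (e, g) \in rho_of zero M T.
Proof.
move=> [_ Tmul] /rho_ofP[eM fM [x xT exf]] /rho_ofP[_ gM [y yT fyg]].
apply/rho_ofP; split=> //; exists (x * y); first exact: Tmul.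
exact: link_mul exf fyg.
Qed.

Lemma sub_Mon_rho_of T : T \subset Mon zero M (rho_of zero M T).
Proof.
by apply/subsetP=> x xT; apply/MonP=> e f eM fM exf; apply/rho_ofP; split=> //; exists x.
Qed.

Lemma rho_of_sub T U : T \subset U -> rho_of zero M T \subset rho_of zero M U.
Proof.
move=> /subsetP TU; apply/subsetP=> -[e f] /rho_ofP[eM fM [x /TU xU exf]].
by apply/rho_ofP; split=> //; exists x.
Qed.

Lemma Mon_sub rho rho' : rho \subset rho' -> Mon zero M rho \subset Mon zero M rho'.
Proof.
move=> /subsetP sub; apply/subsetP=> x /MonP xrho; apply/MonP=> e f eM fM exf.
exact/sub/xrho.
Qed.

(* The level of e counts down from the length of the longest nonzero product of
   elements of T starting at e. *)
Lemma rho_of_levels T m : 0 < m -> set_pow T m = [set zero] ->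
  exists2 h : S -> nat, forall e f, (e, f) \in rho_of zero M T -> h e < h f
                      & forall e, h e < m.
Proof.
move=> m_gt0 Tm.
(* [k] is the number of factors; index 0 is harmless, since [set_pow T 0] is empty and 0 is also the
   value of an empty maximum. *)
pose P e (k : 'I_m) := [exists x in set_pow T k, exists f in M, e * x * f != zero].
pose g e := \max_(k < m | P e k) k.
have g_lt e : g e <= m.-1 by apply/bigmax_leqP=> k _; have := ltn_ord k; lia.
exists (fun e => m.-1 - g e) => [e f /rho_ofP[eM fM [x xT exf]] | e]; last by lia.
suff : g f < g e by have := g_lt e; lia.
(* Prefixing [x] lengthens a non-zero product starting at [f] into one starting at [e]. *)
have extend k y : y \in set_pow T k.+1 -> forall f', f' \in M ->
    f * y * f' != zero -> k.+1 < g e.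
  move=> yT f' f'M fyf; have xyT : x * y \in set_pow T k.+2.
    by rewrite set_powS mem_set_mul.
  have exyf := link_mul eM fM f'M exf fyf.
  have km : k.+2 < m.
    rewrite ltnNge; apply: contra exyf => mk.
    have T0 : T != set0 by apply/set0Pn; exists x.
    have Tk := set_pow_eq0_leq zeroP T0 m_gt0 mk Tm.
    by move: xyT; rewrite Tk inE => /eqP->; rewrite zx0 z0x.
  apply: (@leq_bigmax_cond _ (P e) (fun k : 'I_m => k : nat) (Ordinal km)).
  apply/exists_inP; exists (x * y) => //.
  by apply/exists_inP; exists f'.
(* If no non-zero product starts at [f], then [g f = 0], and [0 < g e] comes from [x] alone as a
   product of one factor; this needs index 1 to be below [m]. *)
have m1 : 1 < m.
  rewrite ltnNge; apply: contra exf => m1; have m_eq : m = 1%N by lia.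
  by move: xT; rewrite m_eq in Tm; rewrite -[T]/(set_pow T 1) Tm inE => /eqP->; rewrite zx0 z0x.
have g1 : 0 < g e.
  apply: (@leq_bigmax_cond _ (P e) (fun k : 'I_m => k : nat) (Ordinal m1)).
  by apply/exists_inP; exists x => //; apply/exists_inP; exists f.
rewrite {1}/g.
have lt_max : forall k : 'I_m, P f k -> k < g e.
  move=> [[|k] km] // /exists_inP[y yT /exists_inP[f' f'M fyf]].
  exact: extend yT f' f'M fyf.
have : \max_(k < m | P f k) k <= (g e).-1.
  by apply/bigmax_leqP=> k /lt_max; lia.
by lia.
Qed.

(** For D-related [e] and [f] some [e * x * f] is non-zero. By orthogonality this element links no
    pair other than [(e, f)], so it belongs to [Mon] as soon as [(e, f)] is in [rho]. *)
Lemma rho_of_Mon rho : rho \subset setX M M ->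
  (forall e f, (e, f) \in rho -> greenD e f) ->
  rho_of zero M (Mon zero M rho) = rho.
Proof.
move=> /subsetP rhoM rhoD; apply/setP=> -[e f].
apply/rho_ofP/idP => [[eM fM [x /MonP xrho exf]]|ef]; first exact: xrho.
have /setXP[eM fM] := rhoM _ ef; split=> //.
have /(greenD_linkP eM fM)[x exf] := rhoD _ _ ef.
have ee := M_idem eM; have ff := M_idem fM.
exists (e * x * f); last by rewrite !mulgA ee -(mulgA _ f) ff.
apply/MonP=> e' f' e'M f'M nz.
have def_e : e' = e.
  by apply: M_orthogonal => //; apply: contraNneq nz => eq0; rewrite !mulgA eq0 !z0x.
have -> : f' = f; last by rewrite def_e.
apply/esym/M_orthogonal => //; apply: contraNneq nz => eq0.
by rewrite -!mulgA eq0 !zx0.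
Qed.

(** By [link_split], a product of [m] elements of [Mon] linking [e] to [f] yields a chain of [m]
    pairs of [rho], along which [h] would rise by [m] while staying below [m]. The chain stays in
    one D-class, so [h] may depend on the class. *)
Lemma Mon_Nil rho m : 0 < m ->
  (forall a b c, (a, b) \in rho -> (b, c) \in rho -> (a, c) \in rho) ->
  (forall e, e \in M -> exists h : S -> nat,
     forall a b, greenD e a -> (a, b) \in rho -> h a < h b < m) ->
  Nil_class_le zero m (Mon zero M rho).
Proof.
move=> m_gt0 tr levels; apply/(Nil_class_leP zeroP _ m_gt0).
have nzMon : Mon zero M rho != set0.
  apply/set0Pn; exists zero; apply/MonP=> e f _ _.
  by rewrite zx0 z0x eqxx.
split.
  split=> // x y /MonP xrho /MonP yrho; apply/MonP=> e g eM gM.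
  by case/link_split=> // f [fM exf fyg]; apply: tr (xrho e f _ _ _) (yrho f g _ _ _).
have chain k x e f (h : S -> nat) : e \in M -> f \in M ->
    (forall a b, greenD e a -> (a, b) \in rho -> h a < h b < m) ->
    x \in set_pow (Mon zero M rho) k.+1 -> e * x * f != zero -> h e + k.+1 <= h f < m.
  move=> eM fM; elim: k x e eM => [|k IHk] x e eM hmono.
    move=> /MonP xrho exf.
    have ee : greenD e e by have := Dclass_refl e; rewrite inE.
    by have := hmono _ _ ee (xrho _ _ eM fM exf); lia.
  rewrite set_powS => /imset2P[y z /MonP yrho zT ->] eyzf.
  have [g [gM eyg gzf]] := link_split eM fM eyzf.
  have De_g : greenD e g by apply/(greenD_linkP eM gM); exists y.
  have ee : greenD e e by have := Dclass_refl e; rewrite inE.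
  have h_eg := hmono _ _ ee (yrho _ _ eM gM eyg).
  (* The next idempotent [g] has the same D-class, so the same [h] serves the rest of the chain. *)
  have eqD := greenD_eq eM gM De_g.
  have hmono_g a b : greenD g a -> (a, b) \in rho -> h a < h b < m.
    move=> ga; apply: hmono; have : a \in Dclass g by rewrite inE.
    by rewrite -eqD inE.
  by have := IHk z g gM hmono_g zT gzf; lia.
have def_m : m = m.-1.+1 by lia.
rewrite def_m; apply: set_pow_eq0 => // x xT; apply/eqP/contraT.
case/M_detects=> e [f [eM fM exf]]; have [h hmono] := levels e eM.
by have := chain _ _ _ _ _ eM fM hmono xT exf; lia.
Qed.

(** * Orders built from ordered partitions, and their maximality *)

Lemma mem_Ord_part m rho e f : Ord_part M m rho -> (e, f) \in rho ->
  exists A, [/\ A \in Dclasses_of M, e \in A & f \in A].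
Proof.
case=> _ [r blocks ->] /bigcupP[A AD efA]; exists A.
by have /setXP[] := subsetP (ord_part_block_sub (blocks A AD)) _ efA.
Qed.

Lemma Ord_part_greenD m rho e f : Ord_part M m rho -> (e, f) \in rho -> greenD e f.
Proof.
move=> ord_rho /(mem_Ord_part ord_rho)[A [AD eA fA]].
by have [_ defA] := DclassesP AD eA; move: fA; rewrite defA inE => /andP[].
Qed.

Lemma Ord_part_levels m rho e : 0 < m -> Ord_part M m rho -> e \in M ->
  exists h : S -> nat, forall a b, greenD e a -> (a, b) \in rho -> h a < h b < m.
Proof.
move=> m_gt0 [_ [r blocks ->]] eM.
have [h hmono] := ord_part_block_levels m_gt0 (blocks _ (D_block_in eM)).
exists h => a b ea /bigcupP[A AD abA]; apply: hmono.
have /setXP[aA bA] := subsetP (ord_part_block_sub (blocks A AD)) _ abA.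
have [aM defA] := DclassesP AD aA.
have a_e : a \in D_block e by rewrite inE aM.
by have [_ ->] := DclassesP (D_block_in eM) a_e; rewrite -defA.
Qed.

(** Pairs of [rho'] stay inside D-blocks, so [ord_part_block_maximal] applies block by block. *)
Lemma Ord_part_maximal m rho rho' (h : S -> nat) :
  Ord_part M m rho -> rho \subset rho' -> rho' \subset setX M M ->
  (forall e f, (e, f) \in rho' -> greenD e f) ->
  (forall e f, (e, f) \in rho' -> h e < h f) -> (forall e, h e < m) ->
  rho' = rho.
Proof.
move=> [_ [r blocks def_rho]] sub rhoM rhoD hmono hm; apply/eqP.
rewrite eqEsubset sub andbT; apply/subsetP=> -[e f] ef.
have /setXP[eM fM] := subsetP rhoM _ ef; have eD := D_block_in eM.
rewrite def_rho; apply/bigcupP; exists (D_block e) => //.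
apply: (ord_part_block_maximal (blocks _ eD) _ hmono hm) => //.
- by apply: subset_trans sub; rewrite def_rho bigcup_sup.
- exact: mem_D_block.
- by rewrite inE fM rhoD.
Qed.

(** Normalizing [h] separately on each D-block keeps every pair of [rho] increasing, and the
    normalized levels define [rho']. *)
Lemma Ord_part_extension m rho (h : S -> nat) : rho \subset setX M M ->
  (forall e f, (e, f) \in rho -> greenD e f) ->
  (forall e f, (e, f) \in rho -> h e < h f) -> (forall e, h e < m) ->
  exists2 rho', Ord_part M m rho' & rho \subset rho'.
Proof.
move=> rhoM rhoD hmono hm.
have /fin_all_exists[H HP] : forall A : {set S}, exists h' : S -> nat,
    onto_levels A (minn m #|A|) h' /\
    {in A &, forall a b, h a < h b -> h' a < h' b}.
  move=> A; have [h' ? ?] := normalize_levels (fun a (_ : a \in A) => hm a).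
  by exists h'.
pose r A := [set p in setX A A | H A p.1 < H A p.2].
have rP A a b : reflect [/\ a \in A, b \in A & H A a < H A b] ((a, b) \in r A).
  by rewrite !inE /= -andbA; apply: and3P.
pose rho' := \bigcup_(A in Dclasses_of M) r A.
have rho'P a b : (a, b) \in rho' ->
    [/\ a \in M, b \in M, D_block a = D_block b & (a, b) \in r (D_block a)].
  case/bigcupP=> A AD ab; have /rP[aA bA _] := ab.
  have [aM defA] := DclassesP AD aA; have [bM defA'] := DclassesP AD bA.
  by split; rewrite -?defA.
exists rho'.
  split; last first.
    by exists r => // A _; apply: onto_levels_block; case: (HP A).
  split.
  - by apply/subsetP=> -[a b] /rho'P[aM bM _ _]; apply/setXP.
  - by move=> a; apply/negP=> /rho'P[_ _ _ /rP[_ _]]; rewrite ltnn.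
  move=> a b c /rho'P[aM bM Dab ab] /rho'P[_ cM Dbc bc].
  apply/bigcupP; exists (D_block a); first exact: D_block_in.
  move: ab bc; rewrite -Dab => /rP[aA _ hab] /rP[_ cA hbc].
  by apply/rP; split=> //; apply: ltn_trans hab hbc.
apply/subsetP=> -[a b] ab; have /setXP[aM bM] := subsetP rhoM _ ab.
apply/bigcupP; exists (D_block a); first exact: D_block_in.
have aA := mem_D_block aM.
have bA : b \in D_block a by rewrite inE bM rhoD.
apply/rP; split=> //.
by have [_] := HP (D_block a); apply=> //; apply: hmono.
Qed.

Lemma rho_of_subM T : rho_of zero M T \subset setX M M.
Proof. by apply/subsetP=> -[e f] /rho_ofP[eM fM _]; apply/setXP. Qed.

Lemma rho_of_Mon_Ord_part m rho : Ord_part M m rho ->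
  rho_of zero M (Mon zero M rho) = rho.
Proof.
move=> ord_rho; apply: rho_of_Mon; first by case: ord_rho => -[].
by move=> e f; apply: Ord_part_greenD ord_rho.
Qed.

Lemma Mon_Ord_part_Nil m rho : 0 < m -> Ord_part M m rho ->
  Nil_class_le zero m (Mon zero M rho).
Proof.
move=> m_gt0 ord_rho; apply: Mon_Nil => //; first by case: ord_rho => -[].
by move=> e; apply: Ord_part_levels.
Qed.

(** If [U] contains [Mon rho] and has class at most [m], its order contains [rho] and has [m]
    levels, hence equals [rho]; then [U] lies in [Mon rho]. *)
Lemma Mon_Ord_part_maximal m rho : 0 < m -> Ord_part M m rho ->
  maximal_in (Nil_class_le zero m) (Mon zero M rho).
Proof.
move=> m_gt0 ord_rho; split; first exact: Mon_Ord_part_Nil.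
move=> U /(Nil_class_leP zeroP _ m_gt0)[sU Um] sub.
apply/eqP; rewrite eqEsubset sub andbT.
have [h hmono hm] := rho_of_levels m_gt0 Um.
have rho_sub : rho \subset rho_of zero M U.
  by rewrite -{1}(rho_of_Mon_Ord_part ord_rho); apply: rho_of_sub.
rewrite -(Ord_part_maximal ord_rho rho_sub (rho_of_subM U) _ hmono hm).
  exact: sub_Mon_rho_of.
exact: rho_of_greenD.
Qed.

(** Extending the order of [T] to some [rho] of [Ord_part] enlarges [T] to [Mon rho], which still
    has class at most [m]; maximality forces equality. *)
Lemma maximal_Nil_Ord_part m T : 0 < m -> maximal_in (Nil_class_le zero m) T ->
  exists2 rho, Ord_part M m rho & T = Mon zero M rho.
Proof.
move=> m_gt0 [nilT maxT]; have [sT Tm] := (Nil_class_leP zeroP _ m_gt0).1 nilT.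
have [h hmono hm] := rho_of_levels m_gt0 Tm.
have [|rho ord_rho sub] := Ord_part_extension (rho_of_subM T) _ hmono hm.
  exact: rho_of_greenD.
exists rho => //; apply/esym/maxT; first exact: Mon_Ord_part_Nil.
exact: subset_trans (sub_Mon_rho_of T) (Mon_sub sub).
Qed.

(** * The largest D-block and the nilpotency class *)

Let n := \max_(A in Dclasses_of M) #|A|.

Lemma max_block_gt0 : M != set0 -> 0 < n.
Proof.
case/set0Pn=> e eM; apply: leq_trans (leq_bigmax_cond _ (D_block_in eM)).
by apply/card_gt0P; exists e; apply: mem_D_block.
Qed.

(** On a D-block [A] the levels compress to at most [#|A| <= n] values, so [Mon_Nil] bounds the
    class of [Mon] of the order of [T], which contains [T]. *)
Lemma nilpotent_Nil_max_block T : M != set0 -> nilpotent_subsemigroup zero T ->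
  Nil_class_le zero n T.
Proof.
move=> M0 nilT; have n_gt0 := max_block_gt0 M0.
have [sT [m m_gt0 Tm]] := nilT; have [h hmono hm] := rho_of_levels m_gt0 Tm.
suff [_ Monn] : subsemigroup (Mon zero M (rho_of zero M T)) /\
    set_pow (Mon zero M (rho_of zero M T)) n = [set zero].
  apply/(Nil_class_leP zeroP _ n_gt0); split=> //; have [T0 _] := sT.
  have def_n : n = n.-1.+1 by lia.
  rewrite def_n; apply: set_pow_eq0 => // x xT; apply/set1P.
  by rewrite -Monn def_n; apply: (subsetP (set_pow_subset n.-1 (sub_Mon_rho_of T))).
apply/(Nil_class_leP zeroP _ n_gt0); apply: Mon_Nil => //.
  by move=> a b c; apply: rho_of_trans.
move=> e eM; have [h' [h'lt _] h'mono] := normalize_levels (A := D_block e)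
  (fun a (_ : a \in D_block e) => hm a).
exists h' => a b ea ab; have /setXP[aM bM] := subsetP (rho_of_subM T) _ ab.
have aA : a \in D_block e by rewrite inE aM.
have bA : b \in D_block e.
  have [_ ->] := DclassesP (D_block_in eM) aA.
  by rewrite inE bM (rho_of_greenD ab).
have := h'lt b bA; have := h'mono a b aA bA (hmono _ _ ab).
have : #|D_block e| <= n by apply: leq_bigmax_cond (D_block_in eM).
by rewrite leq_min; lia.
Qed.

(** [T] is also maximal in [Nil_n], so it comes from some [rho] that cuts a D-block of size [n] into
    [n] blocks. If [T^c = {0}], the last block has height at least [n - 1] but below [c]. *)
Lemma maximal_nilpotent_class T : M != set0 ->
  maximal_in (nilpotent_subsemigroup zero) T -> nilpotency_class zero T n.
Proof.
move=> M0 [nilT maxT]; have n_gt0 := max_block_gt0 M0.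
have Nil_T := nilpotent_Nil_max_block M0 nilT.
have [sT Tn] := (Nil_class_leP zeroP _ n_gt0).1 Nil_T.
split=> // c c_gt0 Tc; have [h hmono hc] := rho_of_levels c_gt0 Tc.
have [|rho ord_rho defT] := @maximal_Nil_Ord_part n T n_gt0.
  by split=> // U [nilU _]; apply: maxT.
have [_ [r blocks def_rho]] := ord_rho.
have [|A AD nA] :=
    @eq_bigmax_cond _ (mem (Dclasses_of M)) (fun A : {set S} => #|A|).
  by have /set0Pn[e eM] := M0; apply/card_gt0P; exists (D_block e); apply: D_block_in.
have := blocks A AD; rewrite /ord_part_block -nA leqnn => -[B pB rA].
have last_n : n.-1 < n by lia.
have [_ nz _] := pB; have /set0Pn[a aB] := nz (Ordinal last_n).
have rA_rho : Ord B \subset rho_of zero M T.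
  rewrite -rA defT (rho_of_Mon_Ord_part ord_rho) {1}def_rho.
  exact: bigcup_sup.
have := Ord_height pB rA_rho hmono aB; have := hc a.
by rewrite /=; lia.
Qed.

End MinimalIdempotents.

Theorem theorem5p15 (S : finSemigroupType) (zero : S) (M : {set S}) (n : nat)
  (zeroP : is_zero zero)
  (R_trivial : forall x : S, in_R zero x <-> x = zero)
  (M_nonempty : M != set0)
  (M_minimal : forall e : S, e \in M -> minimal_idempotent zero e)
  (M_commute : {in M &, forall e f : S, e * f = f * e})
  (M_detects : forall x : S, x != zero ->
     exists e f : S, [/\ e \in M, f \in M & e * x * f != zero])
  (M_insert : forall x y e f : S, e \in M -> f \in M ->
     [set e * x * g * y * f | g in M] \subset [set zero; e * x * y * f] /\
     (e * x * y * f != zero ->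
      [set e * x * g * y * f | g in M] != [set zero]))
  (n_def : n = \max_(A in Dclasses_of M) #|A|) :
  [/\ forall (T : {set S}) (c : nat), nilpotent_subsemigroup zero T ->
        nilpotency_class zero T c -> c <= n,
      forall T : {set S}, maximal_in (nilpotent_subsemigroup zero) T ->
        nilpotency_class zero T n
    & forall m : nat, 0 < m -> m <= n ->
        [/\ forall T : {set S}, maximal_in (Nil_class_le zero m) T ->
              Ord_part M m (rho_of zero M T),
            forall rho : {set S * S}, Ord_part M m rho ->
              maximal_in (Nil_class_le zero m) (Mon zero M rho),
            forall T : {set S}, maximal_in (Nil_class_le zero m) T ->
              Mon zero M (rho_of zero M T) = T
          & forall rho : {set S * S}, Ord_part M m rho ->
              rho_of zero M (Mon zero M rho) = rho]].
Proof.
have Nil_n T : nilpotent_subsemigroup zero T -> Nil_class_le zero n T.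
  by rewrite n_def; apply: nilpotent_Nil_max_block.
split=> [T c nilT [_ _ minc] | T maxT | m m_gt0 mn].
- have [_ [d [d_gt0 Td _] dn]] := Nil_n T nilT.
  exact: leq_trans (minc d d_gt0 Td) dn.
- by rewrite n_def; apply: maximal_nilpotent_class.
have rhoK rho (ord_rho : Ord_part M m rho) : rho_of zero M (Mon zero M rho) = rho.
  exact: rho_of_Mon_Ord_part ord_rho.
have maxP T (maxT : maximal_in (Nil_class_le zero m) T) :
    exists2 rho, Ord_part M m rho & T = Mon zero M rho.
  exact: maximal_Nil_Ord_part.
(* Every maximal [T] has the form [Mon rho], so the claims about [T] reduce to [rhoK]. *)
split=> // [T /maxP[rho ord_rho ->] | rho ord_rho | T /maxP[rho ord_rho ->]].
- by rewrite rhoK.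
- exact: Mon_Ord_part_maximal.
- by rewrite rhoK.
Qed.
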